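(* Let $z_1, z_2 \in \mathbb{C}$ with $z_1 \neq z_2$, and let $$P_1=\begin{bmatrix} 0&1&0\\ 1&0&0\\ 0&0&1\end{bmatrix},\qquad P_2=\begin{bmatrix} 0&0&1\\ 0&1&0\\ 1&0&0\end{bmatrix}.$$ Then the linear differential system $$\frac{dW}{dz}=2\left(\frac{P_1}{z-z_1}+\frac{P_2}{z-z_2}\right)W,$$ where $W(z)$ is a $3\times 3$ matrix function of the complex variable $z$, has a rational fundamental solution.
   Context: A rational fundamental solution of the system is a $3\times 3$ matrix $W(z)$ whose entries are rational functions of $z$ with complex coefficients, which satisfies the differential system (as an identity of matrices of rational functions), and whose determinant $\det W(z)$ is not identically zero. *)

(* Defs.v *)
From mathcomp Require Import all_boot all_order all_algebra.
From mathcomp Require Import complex reals ring.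

Set Implicit Arguments.
Unset Strict Implicit.
Unset Printing Implicit Defensive.

Import GRing.Theory.
Local Open Scope ring_scope.

Notation "p %:F" := (FracField.tofrac p) (format "p %:F") : ring_scope.

Section RationalFunctions.
Variable K : fieldType.
Implicit Types (p q : {poly K}) (f : {fraction {poly K}}).

(* The quotient rule applied to the chosen representative of f; [ratderE]
   shows that the choice of representative is irrelevant. *)
Definition ratder f : {fraction {poly K}} :=
  let p := \n_(repr f) in let q := \d_(repr f) in
  (p^`() * q - p * q^`())%:F / (q ^+ 2)%:F.

Lemma frac_reprE f : f = (\n_(repr f))%:F / (\d_(repr f))%:F.
Proof.
have d0 := denom_ratioP (repr f); set x := repr f.
apply/(canRL (mulfK _)); first by rewrite tofrac_eq0.
rewrite -[f]reprK -/x; unlock FracField.tofrac.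
rewrite -[LHS]FracField.pi_mul; apply/eqP.
rewrite FracField.equivf_def /FracField.mulf.
by rewrite !numden_Ratio ?mulf_neq0 ?oner_eq0 // !mulr1 mulrC.
Qed.

Lemma ratderE p q : q != 0 ->
  ratder (p%:F / q%:F) = (p^`() * q - p * q^`())%:F / (q ^+ 2)%:F.
Proof.
move=> q0; rewrite /ratder; set n := \n_(_); set d := \d_(_).
have d0 : d != 0 := denom_ratioP _.
have e : p * d = n * q.
  apply/eqP; rewrite -tofrac_eq !tofracM -eqr_div ?tofrac_eq0 //.
  by apply/eqP; exact: frac_reprE.
have e' : p^`() * d + p * d^`() = n^`() * q + n * q^`() by rewrite -!derivM e.
apply/eqP; rewrite eqr_div ?tofrac_eq0 ?expf_neq0 // -!tofracM tofrac_eq.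
apply/eqP.
transitivity ((n^`() * q + n * q^`()) * (d * q)
              - n * q * (d^`() * q + q^`() * d)); first by ring.
by rewrite -e -e'; ring.
Qed.

End RationalFunctions.

Section System.
Variable C : fieldType.
Local Notation ratfun := {fraction {poly C}}.

Definition mx3 (K : nmodType) (rows : seq (seq K)) : 'M[K]_3 :=
  \matrix_(i < 3, j < 3) (nth [::] rows i)`_j.

Definition P1 : 'M[ratfun]_3 :=
  mx3 [:: [:: 0; 1; 0];
          [:: 1; 0; 0];
          [:: 0; 0; 1]].

Definition P2 : 'M[ratfun]_3 :=
  mx3 [:: [:: 0; 0; 1];
          [:: 0; 1; 0];
          [:: 1; 0; 0]].

Definition system_mx (z1 z2 : C) : 'M[ratfun]_3 :=
  2 *: ((('X - z1%:P)%:F)^-1 *: P1 + (('X - z2%:P)%:F)^-1 *: P2).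

Definition rational_fundamental_solution (A W : 'M[ratfun]_3) : Prop :=
  map_mx (@ratder C) W = A *m W /\ \det W != 0.

End System.

(* Main.v *)
Require Import Defs.
From mathcomp Require Import all_boot all_order all_algebra.
From mathcomp Require Import complex reals.
From mathcomp Require Import fingroup perm ring.

Import GRing.Theory Num.Theory.

Local Open Scope ring_scope.

(** Write u = z - z1 and v = z - z2. As P1 and P2 fix (1,1,1) and preserve the
plane x + y + z = 0, one solution is u^2 v^2 (1,1,1) and two others lie in that
plane. The residues 2 P1 and 2 P2 have eigenvalues 2, 2, -2, so u^2 v^2 clears
all the denominators, and the eigenvalues of 2 (P1 + P2) bound the degree of
the numerators. Solving the resulting linear equations for the coefficients
gives numerators homogeneous in u and v, for which the system becomes an
identity in u and v; the determinant of the solution is 90 u^2 v^2. *)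

(** Left multiplication by a permutation matrix permutes rows, so the system can be read entry by
    entry. *)
Lemma P1E (K : fieldType) : P1 K = perm_mx (tperm 0 1).
Proof.
apply/matrixP => i j; rewrite !mxE permE.
by case: i j => [[|[|[|i]]] lti] // [[|[|[|j]]] ltj].
Qed.

Lemma P2E (K : fieldType) : P2 K = perm_mx (tperm 0 2%:R).
Proof.
apply/matrixP => i j; rewrite !mxE permE.
by case: i j => [[|[|[|i]]] lti] // [[|[|[|j]]] ltj].
Qed.

(** Divided by u^2 v^2, the columns are homogeneous in u and v of degrees 4, -2 and 2, the
    eigenvalues of 2 (P1 + P2). The last two columns sum to zero. *)
Definition fundamental_numerator (K : comPzRingType) (u v : K) : 'M[K]_3 :=
  mx3 [:: [:: u ^+ 4 * v ^+ 4; 3 * u ^+ 2 + 4 * u * v + 3 * v ^+ 2;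
              u ^+ 4 * (3 * u ^+ 2 - 8 * u * v + 5 * v ^+ 2)];
          [:: u ^+ 4 * v ^+ 4; - (2 * u * v + 3 * v ^+ 2);
              u ^+ 4 * (5 * v ^+ 2 - 2 * u * v)];
          [:: u ^+ 4 * v ^+ 4; - (3 * u ^+ 2 + 2 * u * v);
              u ^+ 4 * (10 * u * v - 3 * u ^+ 2 - 10 * v ^+ 2)]].

Lemma det_fundamental_numerator (K : comPzRingType) (u v : K) :
  \det (fundamental_numerator K u v) = 90 * u ^+ 8 * v ^+ 8.
Proof.
rewrite (expand_det_row _ ord0) !big_ord_recr big_ord0 /= /cofactor.
rewrite !(expand_det_row _ ord0) !big_ord_recr !big_ord0 /= /cofactor.
rewrite !det_mx11 !mxE /=; ring.
Qed.

Definition fundamental_matrix (K : fieldType) (z1 z2 : K) :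
    'M[{fraction {poly K}}]_3 :=
  map_mx (fun p => p%:F / (('X - z1%:P) ^+ 2 * ('X - z2%:P) ^+ 2)%:F)
    (fundamental_numerator _ ('X - z1%:P) ('X - z2%:P)).

(** The term [(u + v) * p] absorbs the derivative of the denominator: if u' = v' = 1, the
    logarithmic derivative of u^2 v^2 is 2 (u + v) / (u v). *)
Lemma quotient_rule_identity (F : fieldType) (u v p dp p1 p2 : F) :
  u != 0 -> v != 0 -> u * v * dp = 2 * ((u + v) * p + v * p1 + u * p2) ->
  (dp * (u ^+ 2 * v ^+ 2) - p * (u *+ 2 * v ^+ 2 + u ^+ 2 * (v *+ 2)))
    / (u ^+ 2 * v ^+ 2) ^+ 2 =
  2 * (u^-1 * (p1 / (u ^+ 2 * v ^+ 2)) + v^-1 * (p2 / (u ^+ 2 * v ^+ 2))).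
Proof.
move=> u0 v0 edp.
have -> : dp = 2 * ((u + v) * p + v * p1 + u * p2) / (u * v).
  by rewrite -edp mulrC mulKf ?mulf_neq0.
by field; rewrite u0 v0.
Qed.

Lemma ratder_quotient (K : fieldType) (u v p p1 p2 : {poly K}) :
  u != 0 -> v != 0 -> u^`() = 1 -> v^`() = 1 ->
  u * v * p^`() = 2 * ((u + v) * p + v * p1 + u * p2) ->
  ratder (p%:F / (u ^+ 2 * v ^+ 2)%:F) =
    2 * (u%:F^-1 * (p1%:F / (u ^+ 2 * v ^+ 2)%:F)
         + v%:F^-1 * (p2%:F / (u ^+ 2 * v ^+ 2)%:F)).
Proof.
move=> u0 v0 du dv dp; rewrite ratderE ?mulf_neq0 ?expf_neq0 //.
rewrite derivM !deriv_exp du dv !mul1r !expr1.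
rewrite !(tofracXn, tofracMn, tofracB, tofracD, tofracM).
apply: quotient_rule_identity; rewrite ?tofrac_eq0 //.
rewrite -!tofracM dp.
by rewrite !(tofracMn, tofrac1, tofracD, tofracM).
Qed.

(** On polynomials in u and v the derivation acts as d/du + d/dv, which leaves nine identities for
    [ring]. *)
Lemma deriv_fundamental_numerator (K : fieldType) (u v : {poly K}) i j :
  let N := fundamental_numerator _ u v in
  u^`() = 1 -> v^`() = 1 ->
  u * v * (N i j)^`() = 2 * ((u + v) * N i j
    + v * N (tperm 0 1 i) j + u * N (tperm 0 2%:R i) j).
Proof.
move=> N du dv; rewrite {}/N.
case: i j => [[|[|[|i]]] lti] // [[|[|[|j]]] ltj] //=.
all: rewrite !mxE !permE /=.
all: by rewrite !derivCE ?derivC ?du ?dv; ring.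
Qed.

Lemma ratder_fundamental_matrix (K : fieldType) (z1 z2 : K) :
  map_mx (@ratder K) (fundamental_matrix K z1 z2)
    = system_mx z1 z2 *m fundamental_matrix K z1 z2.
Proof.
have u0 : 'X - z1%:P != 0 by rewrite polyXsubC_eq0.
have v0 : 'X - z2%:P != 0 by rewrite polyXsubC_eq0.
have du := derivXsubC z1; have dv := derivXsubC z2.
rewrite /fundamental_matrix /system_mx.
(* From here on, [u] and [v] are any nonzero polynomials with derivative 1. *)
move: ('X - z1%:P) ('X - z2%:P) u0 v0 du dv => u v u0 v0 du dv.
rewrite -scalemxAl mulmxDl -!scalemxAl P1E P2E -!row_permE.
apply/matrixP => i j; rewrite !mxE; apply: ratder_quotient => //.
by have := deriv_fundamental_numerator K u v i j du dv; rewrite !mxE.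
Qed.

Lemma det_fundamental_matrix_neq0 (K : numFieldType) (z1 z2 : K) :
  \det (fundamental_matrix K z1 z2) != 0.
Proof.
have u0 : 'X - z1%:P != 0 by rewrite polyXsubC_eq0.
have v0 : 'X - z2%:P != 0 by rewrite polyXsubC_eq0.
rewrite /fundamental_matrix; set q := _ ^+ 2 * _.
set N := fundamental_numerator _ _ _.
have q0 : q != 0 by rewrite mulf_neq0 ?expf_neq0.
have -> : map_mx (fun p => p%:F / q%:F) N
    = q%:F^-1 *: map_mx (@FracField.tofrac _) N.
  by apply/matrixP => i j; rewrite !mxE mulrC.
rewrite detZ det_map_mx det_fundamental_numerator mulf_neq0 //.
  by rewrite expf_neq0 // invr_eq0 tofrac_eq0.
rewrite tofrac_eq0 !mulf_neq0 ?expf_neq0 //.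
(* The constant 90 is nonzero because [K] has characteristic 0. *)
by rewrite -polyC_natr polyC_eq0 pnatr_eq0.
Qed.

Theorem proposition1p2 (R : realType) (z1 z2 : R[i]) (z1_neq_z2 : z1 <> z2) :
  exists W : 'M[{fraction {poly R[i]}}]_3,
    rational_fundamental_solution (system_mx z1 z2) W.
Proof.
exists (fundamental_matrix _ z1 z2); split.
  exact: ratder_fundamental_matrix.
exact: det_fundamental_matrix_neq0.
Qed.
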